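(* Let $k>1$ be a parameter. The communication complexity of constructing a $(4k-2)$-spanner in weighted undirected distributed graphs on $n$ vertices with edges observed at $s$ sites (edge weights in $[1,w]$, with $w$ polynomial in $n$) under the blackboard model, with or without duplication, is $\tilde{O}(s+n^{1+1/k})$. In unweighted graphs, the stretch factor can be reduced to $2k-1$ (that is, a $(2k-1)$-spanner can be constructed within the same communication bound).
   Context: Distributed graph: there are $s$ sites $S_1,\dots,S_s$ with a common vertex set $V$, $|V|=n$; site $S_j$ holds a subset $E_j\subseteq E$ of the edges (with their weights), where $E=\bigcup_{j=1}^s E_j$. Without duplication, the sets $E_j$ are pairwise disjoint; with duplication, they may have non-empty intersections. Blackboard model: sites communicate with each other through a shared blackboard (such as a broadcast channel), whose contents are visible to all. The communication cost is the total number of bits communicated; the communication complexity of a problem is the communication cost needed to solve it. Spanner: an $\alpha$-spanner of $G=(V,E,W)$ is a subgraph $H=(V,E')$, $E'\subseteq E$, with $d_H(u,v)\le \alpha\, d_G(u,v)$ for all $u,v\in V$, where $d$ denotes shortest-path distance (every edge has length $1$ in the unweighted case); $\alpha$ is called the stretch factor. $\tilde{O}$ hides a polylogarithmic factor. *)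

(* Defs.v *)
From HB Require Import structures.
From mathcomp Require Import all_boot all_order all_algebra.
From mathcomp Require Import all_classical all_reals all_analysis.

Set Implicit Arguments.
Unset Strict Implicit.
Unset Printing Implicit Defensive.

Import Order.TTheory GRing.Theory Num.Theory.

Local Open Scope classical_set_scope.
Local Open Scope ring_scope.

(* A deterministic blackboard protocol for s sites, each holding an input in X.
   A node of the tree is a possible content of the blackboard: it fixes the
   site that writes next, and the bit written depends only on that content and
   on the private input of that site. The output is a function of the final
   content of the blackboard, hence is known to every site. *)
Inductive protocol (s : nat) (X Y : Type) : Type :=
| Output (y : Y)
| Write (i : 'I_s) (bit : X -> bool) (next : bool -> protocol s X Y).

Fixpoint blackboard s X Y (p : protocol s X Y) (x : 'I_s -> X) : seq bool :=
  match p with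
  | Output _ => [::]
  | Write i bit next => bit (x i) :: blackboard (next (bit (x i))) x
  end.

Fixpoint output s X Y (p : protocol s X Y) (x : 'I_s -> X) : Y :=
  match p with
  | Output y => y
  | Write i bit next => output (next (bit (x i))) x
  end.

(* p solves, with at most c bits on the blackboard in the worst case, the
   problem of finding an element of [sol g] for every legal instance g, where
   site i only sees [view g i]. *)
Definition solves_with s X Y I (legal : set I) (view : I -> 'I_s -> X)
    (sol : I -> set Y) (p : protocol s X Y) (c : nat) : Prop :=
  forall g, legal g ->
    sol g (output p (view g)) /\ (size (blackboard p (view g)) <= c)%N.

(* The least worst-case cost of a protocol; +oo if no protocol exists. *)
Definition comm_complexity (R : realType) s X Y I (legal : set I)
    (view : I -> 'I_s -> X) (sol : I -> set Y) : \bar R :=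
  ereal_inf [set (c%:R)%:E | c in
    [set c : nat | exists p, solves_with legal view sol p c]].

(* Edges are two-element sets of vertices (see [simple_graph]). The values of
   [weight] outside the edge set are irrelevant. *)
Record dgraph (R : realType) (V : finType) (s : nat) := DGraph {
  part : 'I_s -> {set {set V}};
  weight : {set V} -> R
}.

Section DistributedGraphs.
Variables (R : realType) (V : finType) (s : nat).
Implicit Types (g : dgraph R V s) (F : {set {set V}}).

Definition edges g : {set {set V}} := (\bigcup_(i < s) part g i)%SET.

Definition simple_graph g : Prop := forall e, e \in edges g -> #|e| = 2%N.

Definition no_duplication g : Prop :=
  forall i j : 'I_s, i != j -> (part g i :&: part g j = finset.set0)%SET.

(* Site i knows its own edges together with their weights, and nothing else. *)
Definition site_view g (i : 'I_s) : {ffun {set V} -> option R} :=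
  [ffun e => if e \in part g i then Some (weight g e) else None].

(* Without duplication the parts must be disjoint; with duplication they may
   overlap arbitrarily. *)
Definition dist_graph (dup : bool) : set (dgraph R V s) :=
  [set g | simple_graph g /\ (~~ dup -> no_duplication g)].

Definition weighted_graph (dup : bool) (w : R) : set (dgraph R V s) :=
  [set g | dist_graph dup g /\
           forall e, e \in edges g -> 1 <= weight g e <= w].

Definition unweighted_graph (dup : bool) : set (dgraph R V s) :=
  [set g | dist_graph dup g /\ forall e, e \in edges g -> weight g e = 1].

Definition path_length (W : {set V} -> R) (u : V) (p : seq V) : R :=
  \sum_(l <- pairmap (fun x y => W [set x; y]%SET) u p) l.

(* Shortest-path distance in (V, F, W); it is +oo between distinct components. *)
Definition dist (W : {set V} -> R) F (u v : V) : \bar R :=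
  ereal_inf [set (path_length W u p)%:E | p in
    [set p : seq V |
      path [rel x y | [set x; y]%SET \in F] u p /\ last u p = v]].

Definition spanner (alpha : R) g : set {set {set V}} :=
  [set F : {set {set V}} | F \subset edges g /\
    forall u v, (dist (weight g) F u v
                 <= alpha%:E * dist (weight g) (edges g) u v)%E].

End DistributedGraphs.

Arguments weighted_graph {R V s} dup w.
Arguments unweighted_graph {R V s} dup.

Definition poly_bounded (R : realType) (w : nat -> R) : Prop :=
  exists p : {poly R}, forall n : nat, w n <= p.[n%:R].

(* The value at n and x of the bound hidden in a soft-O of x with constant C and
   polylogarithmic factor of degree d; 1 + ln n rather than ln n makes the
   factor meaningful for n <= 1. *)
Definition soft_bound (R : realType) (C : R) (d n : nat) (x : R) : R :=
  C * (1 + ln n%:R) ^+ d * x.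

(* Main.v *)
(* Unweighted graphs: the sites take turns, and each in turn announces those of
   its edges whose endpoints are not yet joined by a path of at most 2k-1
   announced edges. At the end every edge of the graph is bridged by such a path,
   so the announced graph is a (2k-1)-spanner. It has no cycle of length at most
   2k, so by the Moore bound it has O(n^(1+1/k)) edges; each announcement takes
   O(log n) bits, and one more announcement per site signals the end of its turn.
   Weighted graphs: run this for each level of edges with weight in
   [2^j, 2^(j+1)). Within a level the weights differ by a factor of at most 2,
   which doubles the stretch, and there are O(log w) = O(log n) levels. *)
Require Import Defs.
From mathcomp Require Import all_boot all_order all_algebra zify ring lra.
From mathcomp Require Import all_classical all_reals all_analysis.

Set Implicit Arguments.
Unset Strict Implicit.
Unset Printing Implicit Defensive.

Import Order.TTheory GRing.Theory Num.Theory.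

(** * Graphs without short cycles *)

Local Open Scope nat_scope.

Section Girth.
Variable V : finType.
Implicit Types (F H : {set {set V}}) (u v x y z : V) (p q : seq V).

Definition adj F : rel V := [rel x y | [set x; y]%SET \in F].

Definition two_sets F := forall e, e \in F -> #|e| = 2.

(** Walks rather than simple paths, so that they can be concatenated and reversed freely; length
    counts edges and ignores weights. *)
Definition reach F l x y := exists p, [/\ path (adj F) x p, last x p = y & size p <= l].

Lemma set2_eqP (a b c d : V) :
  [set c; d]%SET = [set a; b]%SET -> c = a /\ d = b \/ c = b /\ d = a.
Proof.
move=> cd; have : a \in [set c; d]%SET by rewrite cd !inE eqxx.
have : b \in [set c; d]%SET by rewrite cd !inE eqxx orbT.
have : c \in [set a; b]%SET by rewrite -cd !inE eqxx.
have : d \in [set a; b]%SET by rewrite -cd !inE eqxx orbT.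
rewrite !inE => /orP [] /eqP -> /orP [] /eqP -> //; try by [left | right].
  by rewrite orbb => /eqP ->; left.
by rewrite orbb => _ /orP [] /eqP ->; left.
Qed.

Lemma adjC F x y : adj F x y = adj F y x.
Proof. by rewrite /adj /= finset.setUC. Qed.

Lemma adj_neq F x y : two_sets F -> adj F x y -> x != y.
Proof. by move=> F2 /F2; rewrite cards2; case: (x != y). Qed.

Lemma sub_adj F H : F \subset H -> subrel (adj F) (adj H).
Proof. by move=> /fintype.subsetP FH x y; apply: FH. Qed.

Lemma reach_sub F H l x y : F \subset H -> reach F l x y -> reach H l x y.
Proof.
by move=> FH [p [xp pl sp]]; exists p; split=> //; apply: sub_path xp; apply: sub_adj.
Qed.

Lemma reach_path F x p : path (adj F) x p -> reach F (size p) x (last x p).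
Proof. by move=> xp; exists p. Qed.

Lemma reach_trans F l m x y z :
  reach F l x y -> reach F m y z -> reach F (l + m) x z.
Proof.
move=> [p [xp py sp]] [q [yq qz sq]]; exists (p ++ q).
by rewrite cat_path last_cat py size_cat xp yq qz leq_add.
Qed.

Lemma reach_leq F l m x y : l <= m -> reach F l x y -> reach F m x y.
Proof. by move=> lm [p [xp py sp]]; exists p; split=> //; apply: leq_trans lm. Qed.

Lemma reachC F l x y : reach F l x y -> reach F l y x.
Proof.
move=> [p [xp <- sp]]; exists (rev (belast x p)).
rewrite rev_path size_rev size_belast; split=> //.
  by rewrite (eq_path (e' := adj F)) // => a b; rewrite -[LHS]/(adj F b a) adjC.
by case: p {xp sp} => //= a p; rewrite rev_cons last_rcons.
Qed.

(* Equivalent to having no cycle of length at most [2 * k]. *)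
Definition unique_short_paths k F := forall x p q,
  path (adj F) x p -> path (adj F) x q -> uniq (x :: p) -> uniq (x :: q) ->
  last x p = last x q -> size p <= k -> size q <= k -> p = q.

(** A simple path crosses the added edge at most once, since it never returns to the endpoint
    through which it entered that edge. *)
Lemma uniq_path_setU1 H a b x p :
  path (adj ([set a; b]%SET |: H)) x p -> uniq (x :: p) ->
  path (adj H) x p \/
  exists c d p1 p2, [/\ [set c; d]%SET = [set a; b]%SET, p = p1 ++ d :: p2,
    path (adj H) x p1, last x p1 = c & path (adj H) d p2].
Proof.
elim: p x => [|y p IH] x; first by left.
rewrite [path _ _ _]/= => /andP [xy yp] xyp.
have Uyp : uniq (y :: p) by case/andP: xyp.
case: (boolP (adj H x y)) => [Hxy|nHxy].
  case: (IH y yp Uyp) => [Hyp|[c [d [p1 [p2 [cd -> yp1 p1c dp2]]]]]].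
    by left; rewrite /= Hyp andbT.
  by right; exists c, d, (y :: p1), p2; split=> //=; rewrite yp1 andbT.
have {}xy : [set x; y]%SET = [set a; b]%SET.
  by move: xy; rewrite /adj /= in_setU1 => /orP [/eqP //|Hxy]; case/negP: nHxy.
right; exists x, y, [::], p; split=> //.
have xp : x \notin y :: p by case/andP: xyp.
have P : {in [pred z | z != x] &, subrel (adj ([set a; b]%SET |: H)) (adj H)}.
  move=> c d /= cx dx; rewrite /adj /= in_setU1 -xy => /orP [/eqP cd|//].
  have : x \in [set c; d]%SET by rewrite cd !inE eqxx.
  by move: cx dx; rewrite !inE => /negPf + /negPf; rewrite ![x == _]eq_sym => -> ->.
apply: (sub_in_path P) yp; apply/allP => z zp; rewrite inE.
by apply: contraNneq xp => <-.
Qed.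

(** Suppose one of two short paths with common ends crosses the new edge. If the other avoids it, or
    crosses it the opposite way, pieces of the two paths join [a] to [b] by fewer than [2 * k] edges
    of [H], which is excluded. If both cross it the same way, uniqueness in [H] applies to the
    prefixes and to the suffixes. *)
Lemma unique_short_pathsU1 k H a b : unique_short_paths k H ->
  ~ reach H k.*2.-1 a b -> unique_short_paths k ([set a; b]%SET |: H).
Proof.
move=> HQ far.
have {}far c d l : [set c; d]%SET = [set a; b]%SET -> l < k.*2 -> ~ reach H l c d.
  move=> cd lk ncd; apply: far.
  have {ncd} : reach H k.*2.-1 c d by apply: reach_leq ncd; lia.
  by case: (set2_eqP cd) => -[-> ->] // /reachC.
have one x p q c d p1 p2 : [set c; d]%SET = [set a; b]%SET ->
    p = p1 ++ d :: p2 -> path (adj H) x p1 -> last x p1 = c ->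
    path (adj H) d p2 -> path (adj H) x q -> last x p = last x q ->
    size p <= k -> size q <= k -> False.
  move=> cd -> xp1 p1c dp2 xq; rewrite last_cat size_cat /= => pq pk qk.
  apply: (far c d (size p1 + size q + size p2) cd); first by lia.
  apply: (reach_trans (y := last x q)).
    apply: (reach_trans (y := x)); last exact: reach_path.
    by rewrite -p1c; apply/reachC/reach_path.
  by rewrite -pq; apply/reachC/reach_path.
move=> x p q xp xq Up Uq pq pk qk.
case: (uniq_path_setU1 xp Up) => [{}xp|[c [d [p1 [p2 [cd Ep xp1 p1c dp2]]]]]];
  case: (uniq_path_setU1 xq Uq) => [{}xq|[c' [d' [q1 [q2 [cd' Eq xq1 q1c dq2]]]]]].
- exact: HQ pq pk qk.
- by case: (one _ _ _ _ _ _ _ cd' Eq xq1 q1c dq2 xp).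
- by case: (one _ _ _ _ _ _ _ cd Ep xp1 p1c dp2 xq).
subst p q; move: pk qk Up Uq pq; rewrite !size_cat => pk qk; rewrite /= in pk qk.
rewrite -(cat_cons x p1) -(cat_cons x q1) !cat_uniq !last_cat /=.
move=> /and3P [Up1 _ Up2] /and3P [Uq1 _ Uq2] pq.
have [[cc' dd']|[cd'E dc'E]] := set2_eqP (etrans cd (esym cd')).
  subst d' c'; congr (_ ++ _ :: _).
    by apply: (HQ x _ _ xp1 xq1 Up1 Uq1); [rewrite p1c | clear -pk; lia | clear -qk; lia].
  by apply: (HQ d _ _ dp2 dq2 Up2 Uq2 pq); [clear -pk; lia | clear -qk; lia].
case: (far c d (size p1 + size q1) cd); first by clear -pk qk; lia.
apply: (reach_trans (y := x)); first by rewrite -p1c; apply/reachC/reach_path.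
by rewrite dc'E -q1c; apply: reach_path.
Qed.

Lemma unique_short_paths0 k : unique_short_paths k finset.set0.
Proof.
by move=> x [|y p] [|z q] //=; rewrite /adj /= ?finset.in_set0.
Qed.

(** * Minimum degree and the Moore bound *)

Definition neighbours F (U : {set V}) x := [set y in U | adj F x y]%SET.

(* A minimal vertex set inducing more than [D] edges per vertex has minimum
   degree greater than [D], since vertices of lower degree could be removed. *)
Lemma dense_min_degree F D : two_sets F -> #|V| * D < #|F| ->
  exists (U : {set V}) x, x \in U /\ {in U, forall y, D < #|neighbours F U y|}.
Proof.
move=> F2 DF; pose ind (U : {set V}) := [set e in F | e \subset U]%SET.
have VD : #|[set: V]%SET| * D < #|ind [set: V]%SET|.
  rewrite cardsT (leq_trans DF) // subset_leq_card //.
  by apply/fintype.subsetP => e eF; rewrite inE eF finset.subsetT.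
have [|U /minsetP [UD Umin]] := @ex_minset _ (fun U => #|U| * D < #|ind U|).
  by exists [set: V]%SET.
have /card_gt0P [e] : 0 < #|ind U| by apply: leq_ltn_trans UD.
rewrite inE => /andP [/F2 e2 /fintype.subsetP eU].
have /card_gt0P [x xe] : 0 < #|e| by rewrite e2.
exists U, x; split; first exact: eU.
move=> y yU; rewrite ltnNge; apply/negP => degy.
have : ~~ (#|(U :\ y)%SET| * D < #|ind (U :\ y)%SET|).
  apply/negP => /Umin /(_ (subsetDl _ _)) E.
  by move: yU; rewrite -E !inE eqxx.
rewrite -leqNgt; apply/negP; rewrite -ltnNge.
(* Removing [y] loses only the edges from [y] to its neighbours in [U], at most [D] of them, so
   [U :\ y] would still be dense. *)
have indU : ind U \subset
    (ind (U :\ y)%SET :|: [set [set y; z]%SET | z in neighbours F U y])%SET.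
  apply/fintype.subsetP => f; rewrite !inE => /andP [fF fU].
  rewrite fF subsetD1 fU /=; case: (boolP (y \in f)) => //= yf.
  have /eqP/cards2P [a [b [ab fab]]] := F2 f fF.
  apply/finset.imsetP; move: yf fU; rewrite fab !inE => /orP [] /eqP -> /fintype.subsetP fU.
    by exists b; rewrite // inE /adj /= -fab fF fU // !inE eqxx orbT.
  exists a; last by rewrite finset.setUC.
  by rewrite inE /adj /= finset.setUC -fab fF fU // !inE eqxx.
move: UD; rewrite (cardsD1 y U) yU add1n mulSn addnC => UD.
rewrite -(ltn_add2r D) (leq_trans UD) // (leq_trans (subset_leq_card indU)) //.
rewrite cardsU (leq_trans (leq_subr _ _)) // leq_add2l.
exact: leq_trans (leq_imset_card _ _) degy.
Qed.

(** If [z] occurred before the penultimate vertex, the rest of the path from [z] and the single edge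
    from [z] to its end would be two different short simple paths with the same ends. *)
Lemma uniq_path_neighbour k F x p z : 0 < k -> two_sets F ->
  unique_short_paths k F -> size p <= k -> path (adj F) x p -> uniq (x :: p) ->
  adj F (last x p) z -> z \in x :: p -> z = last x (belast x p).
Proof.
move=> k0 F2 FQ pk xp Up yz zp.
case/lastP: p pk xp Up yz zp => [|p y] pk xp Up.
  by move=> /(adj_neq F2) /=; rewrite inE eq_sym => /negPf ->.
rewrite last_rcons belast_rcons => yz.
have /negPf zy : z != y by rewrite eq_sym (adj_neq F2 yz).
rewrite -rcons_cons mem_rcons inE zy /=.
rewrite -/(x :: p) => zp; move: pk xp Up.
case/splitPl: zp => p1 p2 p1z; rewrite last_cat p1z.
rewrite size_rcons size_cat -cats1 -catA cat_path p1z => pk /andP [_ zp2] Up.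
have {}Up : uniq (z :: p2 ++ [:: y]).
  by move: Up; rewrite -cat_cons lastI p1z cat_rcons cat_uniq => /and3P [].
have /(congr1 size) : p2 ++ [:: y] = [:: y].
  apply: (FQ z) => //; rewrite ?last_cat ?size_cat //=; last by lia.
    by rewrite adjC yz.
  by rewrite inE zy.
by rewrite size_cat addn1 => -[/size0nil ->].
Qed.

(* A subgraph of minimum degree greater than [D] has at least [D ^ k] simple paths
   of length [k] from a given vertex, and their ends are distinct. *)
Lemma moore_bound k F D : 0 < k -> two_sets F -> unique_short_paths k F ->
  #|V| < D ^ k -> #|F| <= #|V| * D.
Proof.
move=> k0 F2 FQ VD; rewrite leqNgt; apply/negP => /(dense_min_degree F2).
move=> [U [x [xU Udeg]]].
have lists j : j <= k -> exists L : seq (seq V), [/\ uniq L, D ^ j <= size L &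
    forall p, p \in L ->
      [/\ path (adj F) x p, uniq (x :: p), last x p \in U & size p = j]].
  elim: j => [|j IH] jk.
    by exists [:: [::]]; split=> // p; rewrite inE => /eqP ->.
  case: (IH (ltnW jk)) => L [UL DL PL].
  pose ext p := [set z in neighbours F U (last x p) | z \notin x :: p]%SET.
  exists [seq rcons p z | p <- L, z <- enum (ext p)]; split.
  - apply: allpairs_uniq_dep => // [p _|]; first exact: enum_uniq.
    move=> [p z] [q t] _ _ /= /rcons_inj [-> ->] //.
  - rewrite size_allpairs_dep expnSr.
    apply: (@leq_trans (size L * D)); first by rewrite leq_mul2r DL orbT.
    have: forall p, p \in L -> D <= size (enum (ext p)).
      move=> p /PL [xp Up pU pj]; rewrite -cardE.
      (* The end of [p] has more than [D] neighbours in [U], and only its predecessor on [p] is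
         ruled out as a continuation. *)
      rewrite -ltnS (leq_trans (Udeg _ pU)) //.
      rewrite (cardsD1 (last x (belast x p))) -add1n leq_add ?leq_b1 //.
      apply/subset_leq_card/fintype.subsetP => z; rewrite !inE => /andP [zb /andP [zU yz]].
      rewrite zU yz /=; apply: contraNN zb => zp; apply/eqP.
      by apply: (@uniq_path_neighbour k F) => //; lia.
    move=> extD; rewrite sumnE big_map -sum1_size big_distrl /= !big_seq.
    by apply: leq_sum => p /extD; rewrite mul1n.
  - move=> w /allpairsPdep [p [z [/PL [xp Up pU pj]]]].
    rewrite mem_enum !inE => /andP[/andP[zU yz] zp] ->{w}.
    rewrite rcons_path xp yz last_rcons size_rcons pj zU; split=> //.
    by rewrite -rcons_cons rcons_uniq inE zp.
have [L [UL DL PL]] := lists k (leqnn k).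
(* Distinct paths of length [k] have distinct ends, so [D ^ k] vertices would fit into [V]. *)
have : uniq (map (last x) L).
  rewrite map_inj_in_uniq // => p q /PL [xp Up _ pk] /PL [xq Uq _ qk] pq.
  by apply: (FQ x); rewrite ?pk ?qk.
move=> /card_uniqP; rewrite size_map => cL.
have := max_card (mem (map (last x) L)); rewrite cL; lia.
Qed.

End Girth.

(** * Protocols *)

Section Protocols.
Variables (s : nat) (X : Type).

(* Site [i] communicates [f x], known to be one of the at most [2 ^ c] elements
   of [r], by [c] bisections of [r]; [t0] is a junk value. *)
Fixpoint tell (T : eqType) Y (i : 'I_s) (f : X -> T) c (r : seq T) (t0 : T)
    (next : T -> protocol s X Y) : protocol s X Y :=
  if c is c'.+1 then
    Write i (fun x => f x \in take (2 ^ c') r)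
      (fun b => tell i f c' (if b then take (2 ^ c') r else drop (2 ^ c') r) t0 next)
  else next (head t0 r).

Lemma tellP (T : eqType) Y i (f : X -> T) c r t0 (next : T -> protocol s X Y) x :
  f (x i) \in r -> size r <= 2 ^ c ->
  output (tell i f c r t0 next) x = output (next (f (x i))) x /\
  size (blackboard (tell i f c r t0 next) x) = c + size (blackboard (next (f (x i))) x).
Proof.
elim: c r => [|c IH] r fr rc /=.
  case: r fr rc => [|t [|t' r]] //=; rewrite inE => /eqP -> //.
rewrite addSn; set b := _ \in _.
have [||-> ->] // := IH (if b then take (2 ^ c) r else drop (2 ^ c) r).
  case: (boolP b) => // nb; move: fr; rewrite -{1}(cat_take_drop (2 ^ c) r) mem_cat.
  by rewrite -/b (negPf nb).
by case: b; rewrite ?size_take_min ?size_drop; move: rc; rewrite expnS; lia.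
Qed.

(** Sequential composition: the second protocol may depend on the first output because every site
    can read it off the blackboard. *)
Fixpoint bind Y Z (p : protocol s X Y) (next : Y -> protocol s X Z) : protocol s X Z :=
  match p with
  | Output y => next y
  | Write i bit p' => Write i bit (fun b => bind (p' b) next)
  end.

Lemma bindP Y Z (p : protocol s X Y) (next : Y -> protocol s X Z) x :
  output (bind p next) x = output (next (output p x)) x /\
  size (blackboard (bind p next) x) =
    size (blackboard p x) + size (blackboard (next (output p x)) x).
Proof. by elim: p => [y|i bit p' IH] //=; case: (IH (bit (x i))) => -> ->. Qed.

End Protocols.

(** Each site preprocesses its private input by [f], at no cost in communication. *)
Fixpoint comap s X X' Y (f : X' -> X) (p : protocol s X Y) : protocol s X' Y :=
  match p with
  | Output y => Output s X' y
  | Write i bit p' => Write i (bit \o f) (fun b => comap f (p' b))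
  end.

Lemma comapP s X X' Y (f : X' -> X) (p : protocol s X Y) x :
  output (comap f p) x = output p (f \o x) /\
  blackboard (comap f p) x = blackboard p (f \o x).
Proof. by elim: p => [y|i bit p' IH] //=; case: (IH (bit (f (x i)))) => -> ->. Qed.

(** * The greedy protocol for a single level *)

Section Greedy.
Variables (V : finType) (s k : nat).
Implicit Types (F H : {set {set V}}) (x : 'I_s -> {set {set V}}).

(** The next announcement of a site holding [F]; [None] ends its turn. There are [#|V| ^ 2 + 1]
    possible messages, which fixes the number of bits needed. *)
Definition missing H F : option (V * V) :=
  [pick e | ([set e.1; e.2]%SET \in F) && ~~ `[< reach H k.*2.-1 e.1 e.2 >]].

(** [N] is fuel, bounding the number of announcements, since a site keeps its turn after announcing
    an edge. [H] is the graph announced so far. *)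
Fixpoint greedy c N (todo : seq 'I_s) H : protocol s {set {set V}} {set {set V}} :=
  match N, todo with
  | N'.+1, i :: todo' =>
      tell i (missing H) c (enum {: option (V * V)}) None (fun m =>
        if m is Some (a, b) then greedy c N' todo ([set a; b]%SET |: H)
        else greedy c N' todo' H)
  | _, _ => Output s _ H
  end.

Definition hop_spanner l F H := H \subset F /\
  forall a b, [set a; b]%SET \in F -> reach H l a b.

(* Every step of the run ends a turn or adds an edge, hence the measure in the
   last hypothesis; by the Moore bound the fuel [N] cannot run out before [todo]. *)
Lemma greedyP c D N todo H x : 0 < k -> #|V| < D ^ k -> (#|V| ^ 2).+1 <= 2 ^ c ->
  let E := (\bigcup_i x i)%SET in
  two_sets E -> H \subset E -> unique_short_paths k H ->
  (forall i a b, i \notin todo -> [set a; b]%SET \in x i -> reach H k.*2.-1 a b) ->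
  size todo + #|V| * D <= N + #|H| ->
  hop_spanner k.*2.-1 E (output (greedy c N todo H) x) /\
  size (blackboard (greedy c N todo H) x) <= c * N.
Proof.
move=> k0 VD Vc E E2; elim: N todo H => [|N IH] [|i todo] H HE HQ Hdone HN /=.
- split=> //; split=> // a b /bigcupP [i _]; exact: Hdone.
(* No fuel but a turn still pending: the measure would force [H] to have more edges than the Moore
   bound allows. *)
- have : #|H| <= #|V| * D.
    by apply: moore_bound HQ VD => // e /(fintype.subsetP HE) /E2.
  by move: HN; rewrite /=; lia.
- split=> //; split=> // a b /bigcupP [i _]; exact: Hdone.
set next := fun m : option (V * V) => _.
have [||-> ->] := @tellP s _ _ _ i (missing H) c (enum {: option (V * V)}) None next x.
- by rewrite mem_enum.
- by rewrite -cardE card_option card_prod.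
rewrite mulnS leq_add2l /next /missing; case: pickP => [[a b] /= /andP [ab /asboolPn far]|none].
  (* An edge already in [H] would bridge its own endpoints, so each announced edge is new and the
     measure is kept. *)
  have abH : [set a; b]%SET \notin H.
    apply/negP => abH; apply: far; exists [:: b]; split=> //=; last by lia.
    by rewrite andbT.
  apply: IH => //.
  - apply/fintype.subsetP => e; rewrite in_setU1 => /orP [/eqP ->|/(fintype.subsetP HE) //].
    by apply/bigcupP; exists i.
  - exact: unique_short_pathsU1.
  - by move=> j c' d jn /(Hdone _ _ _ jn); apply/reach_sub/finset.subsetUr.
  - by move: HN; rewrite cardsU1 abH /=; lia.
apply: IH => // j a b jn.
have [->|ji] := eqVneq j i.
  by move=> ab; have := none (a, b); rewrite /= ab /= => /negbFE /asboolP.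
by apply: Hdone; rewrite inE negb_or ji.
Qed.

Lemma greedy_spanner c D : 0 < k -> #|V| < D ^ k -> (#|V| ^ 2).+1 <= 2 ^ c ->
  exists p : protocol s {set {set V}} {set {set V}}, forall x,
    two_sets (\bigcup_i x i)%SET ->
    hop_spanner k.*2.-1 (\bigcup_i x i)%SET (output p x) /\
    size (blackboard p x) <= c * (s + #|V| * D).
Proof.
(* The fuel pays for [s] ends of turn and at most [#|V| * D] edges. *)
move=> k0 VD Vc; exists (greedy c (s + #|V| * D) (enum 'I_s) finset.set0) => x x2.
apply: greedyP VD Vc _ _ _ _ _ => //.
- exact: finset.sub0set.
- exact: unique_short_paths0.
- by move=> i a b; rewrite mem_enum.
- by rewrite size_enum_ord cards0 addn0.
Qed.

End Greedy.

(** The runs of [p] on the inputs [f j \o x] are performed one after the other, accumulating the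
    union of their outputs. *)
Lemma bigcup_protocol (V : finType) s X X' (f : nat -> X' -> X)
    (p : protocol s X {set V}) L :
  exists q : protocol s X' {set V}, forall x,
    output q x = (\bigcup_(j < L) output p (f j \o x))%SET /\
    size (blackboard q x) = \sum_(j < L) size (blackboard p (f j \o x)).
Proof.
elim: L => [|L [q qP]].
  by exists (Output s X' finset.set0) => x; rewrite !big_ord0.
exists (bind q (fun A => bind (comap (f L) p) (fun B => Output s X' (A :|: B)%SET))) => x.
do 2!rewrite ?(proj1 (bindP _ _ _)) ?(proj2 (bindP _ _ _)) /=.
have [-> ->] := comapP (f L) p x; have [-> ->] := qP x.
by rewrite addn0 !big_ord_recr.
Qed.

(** * Stretch *)

Local Open Scope classical_set_scope.
Local Open Scope ring_scope.

Section Stretch.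
Variables (R : realType) (V : finType).
Implicit Types (W : {set V} -> R) (F : {set {set V}}).

Lemma path_length_cons W u x p :
  path_length W u (x :: p) = W [set u; x]%SET + path_length W x p.
Proof. by rewrite /path_length big_cons. Qed.

Lemma path_length_cat W u p q :
  path_length W u (p ++ q) = path_length W u p + path_length W (last u p) q.
Proof. by rewrite /path_length pairmap_cat big_cat. Qed.

Lemma path_length_le W F r u p : {in F, forall e, W e <= r} ->
  path (adj F) u p -> path_length W u p <= (size p)%:R * r.
Proof.
move=> Wr; elim: p u => [|x p IH] u /=; first by rewrite /path_length big_nil mul0r.
move=> /andP [ux /IH xp]; rewrite path_length_cons -natr1 mulrDl mul1r addrC.
exact: lerD xp (Wr _ ux).
Qed.

(** Replace each edge of a path by its detour in [F] and concatenate the detours. *)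
Lemma spanner_edgewise s (g : dgraph R V s) F (alpha : R) : 0 < alpha ->
  F \subset edges g ->
  (forall x y, [set x; y]%SET \in edges g -> exists p,
    [/\ path (adj F) x p, last x p = y &
        path_length (weight g) x p <= alpha * weight g [set x; y]%SET]) ->
  spanner alpha g F.
Proof.
(* Dividing by [alpha] leaves a lower bound on an infimum, so one path at a time suffices;
   disconnected pairs are covered by the empty infimum. *)
move=> a0 FE Fedge; split=> // u v; rewrite -lee_pdivrMl //.
apply: le_ereal_inf_tmp => _ [p [up pv] <-]; rewrite lee_pdivrMl // -EFinM.
have [q [uq qv lq]] : exists q, [/\ path (adj F) u q, last u q = v &
    path_length (weight g) u q <= alpha * path_length (weight g) u p].
  elim: p u up pv => [|x p IH] u /=.
    by exists [::]; rewrite /path_length !big_nil mulr0.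
  move=> /andP [/Fedge [q [uq qx lq]] /IH{}IH] /IH [t [xt tv lt]].
  exists (q ++ t); rewrite cat_path last_cat path_length_cat path_length_cons qx.
  by rewrite uq xt tv mulrDr lerD.
by apply: ge_ereal_inf; exists (path_length (weight g) u q)%:E; first by exists q.
Qed.

Lemma site_view_level s (g : dgraph R V s) (P : R -> bool) :
  (\bigcup_(i < s) [set e | if site_view g i e is Some r then P r else false])%SET
    = [set e in edges g | P (weight g e)]%SET.
Proof.
apply/setP => e; rewrite inE; apply/bigcupP/andP => [[i _]|[/bigcupP [i _ ei] Pe]].
  rewrite inE ffunE; case: ifP => // ei Pe; split=> //.
  by apply/bigcupP; exists i.
by exists i => //; rewrite inE ffunE ei.
Qed.

(** Weighted and unweighted graphs share this statement: [lvl] is dyadic with [beta = 2] for the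
    former, a single level with [beta = 1] for the latter. *)
Lemma level_protocol s k c D L (legal : set (dgraph R V s)) (lvl : nat -> R -> bool)
    (beta : R) :
  (0 < k)%N -> (#|V| < D ^ k)%N -> ((#|V| ^ 2).+1 <= 2 ^ c)%N -> 0 < beta ->
  (forall g, legal g -> simple_graph g) ->
  (forall g e, legal g -> e \in edges g ->
    0 <= weight g e /\ exists2 j, (j < L)%N & lvl j (weight g e)) ->
  (forall j r t, lvl j r -> lvl j t -> r <= beta * t) ->
  exists p, solves_with legal (@site_view R V s)
    (@spanner R V s (beta * (2 * k%:R - 1))) p (L * (c * (s + #|V| * D))).
Proof.
move=> k0 VD Vc b0 Lsimple Llvl Lbeta.
have [p0 p0P] := @greedy_spanner V s k c D k0 VD Vc.
pose f j (v : {ffun {set V} -> option R}) :=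
  [set e | if v e is Some r then lvl j r else false]%SET.
have [p pP] := bigcup_protocol f p0 L.
exists p => g lg; have [-> ->] := pP (site_view g).
pose E j := [set e in edges g | lvl j (weight g e)]%SET.
have fE j : (\bigcup_i (f j \o site_view g) i)%SET = E j := site_view_level g (lvl j).
have HP j := p0P (f j \o site_view g).
have {}HP j : hop_spanner k.*2.-1 (E j) (output p0 (f j \o site_view g)) /\
    (size (blackboard p0 (f j \o site_view g)) <= c * (s + #|V| * D))%N.
  by rewrite -fE; apply: HP => e; rewrite fE inE => /andP [/(Lsimple _ lg)].
split; last first.
  rewrite -[X in (_ <= X * _)%N]card_ord -sum_nat_const.
  by apply: leq_sum => j _; case: (HP j).
have k2 : (2 * k%:R - 1 : R) = k.*2.-1%:R.
  by case: (k) k0 => // k' _; rewrite doubleS -natr1 -mul2n -[in RHS]natr1 natrM; ring.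
apply: spanner_edgewise.
- by rewrite mulr_gt0 // k2 ltr0n; lia.
- apply/bigcupsP => j _; apply: fintype.subset_trans (HP j).1.1 _.
  by apply/fintype.subsetP => e; rewrite inE => /andP [].
move=> x y xy; have [W0 [j jL lj]] := Llvl _ _ lg xy.
have [[HE Hreach] _] := HP j.
have /Hreach [p' [xp' py sp]] : [set x; y]%SET \in E j by rewrite inE xy.
exists p'; split=> //.
  apply: sub_path xp'; apply: sub_adj.
  exact: (@finset.bigcup_sup _ _ (Ordinal jL) _
    (fun i : 'I_L => output p0 (f i \o site_view g))).
(* The detour has at most [2 * k - 1] edges, all from the level of the bridged edge, so each weighs
   at most [beta] times as much. *)
apply: (@le_trans _ _ ((size p')%:R * (beta * weight g [set x; y]%SET))).
  apply: path_length_le xp' => e /(fintype.subsetP HE); rewrite inE => /andP [_ le].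
  exact: Lbeta le lj.
by rewrite k2 mulrCA -mulrA ler_wpM2l ?(ltW b0) // ler_wpM2r // ler_nat.
Qed.

End Stretch.

(** * Cost *)

Section Asymptotics.
Variable R : realType.

Lemma ln_nat_ge0 n : 0 <= ln n%:R :> R.
Proof. by case: n => [|n]; [rewrite ln0 | rewrite ln_ge0 // ler1n]. Qed.

(** For [n > 1], taking logarithms in [2 ^ (up_log 2 n - 1) < n] gives
    [up_log 2 n <= 1 + ln n / ln 2]. *)
Lemma up_log2_ln (n : nat) :
  (up_log 2 n)%:R <= (1 + (ln 2)^-1) * (1 + ln n%:R) :> R.
Proof.
have ln2 : 0 < ln 2 :> R by rewrite ln_gt0 // ltr1n.
have [n1|n1] := leqP n 1.
  have -> : up_log 2 n = 0%N by apply/eqP; rewrite up_log_eq0 n1 orbT.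
  have -> : ln n%:R = 0 :> R by case: n n1 => [|[|]] // _; rewrite ?ln1 ?ln0.
  by rewrite addr0 mulr1 addr_ge0 // invr_ge0 ltW.
have lnn := ln_nat_ge0 n.
have : ((up_log 2 n).-1)%:R * ln 2 <= ln n%:R :> R.
  rewrite mulr_natl -lnXn // -natrX ler_ln ?posrE ?ltr0n ?expn_gt0 //; last by lia.
  by rewrite ler_nat ltnW // up_log_gtn.
rewrite -ler_pdivlMr // => H.
have u0 : (0 < up_log 2 n)%N by rewrite up_log_gt0.
rewrite -(prednK u0) -natr1.
have : 0 <= (ln 2)^-1 :> R by rewrite invr_ge0 ltW.
move: H lnn; set a := ln n%:R; set b := (ln 2)^-1; set m := _.-1%:R; nra.
Qed.

Lemma poly_levels (w : nat -> R) : poly_bounded w -> exists C : R, 0 <= C /\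
  forall n, exists L, ((0 < n)%N -> w n < 2 ^+ L) /\ L%:R <= C * (1 + ln n%:R).
Proof.
move=> [p wp]; pose A := \sum_(i < size p) `|p`_i|; pose a := Num.bound A.
pose K : R := 1 + (ln 2)^-1.
have K0 : 0 <= K by rewrite addr_ge0 // invr_ge0 ln_nat_ge0.
exists (a%:R + (size p)%:R * K); split; first by rewrite addr_ge0 // mulr_ge0.
(* [2 ^ a] exceeds the sum [A] of the absolute coefficients, and [2 ^ up_log 2 n] is at least [n];
   together they dominate [A * n ^ size p]. *)
move=> n; exists (a + size p * up_log 2 n)%N; split=> [n0|].
  have nA : w n <= A * n%:R ^+ size p.
    apply: le_trans (wp n) _; rewrite horner_coef /A mulr_suml.
    apply: ler_sum => i _; apply: le_trans (ler_norm _) _.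
    rewrite normrM normrX normr_nat ler_wpM2l // ler_weXn2l // ?ler1n //.
    by rewrite ltnW.
  apply: le_lt_trans nA _; rewrite exprD mulnC exprM.
  have np : 0 < n%:R ^+ size p :> R by rewrite exprn_gt0 // ltr0n.
  apply: (@lt_le_trans _ _ (2 ^+ a * n%:R ^+ size p)).
    rewrite ltr_pM2r //; apply: (@lt_trans _ _ a%:R).
      by apply: archi_boundP; apply: sumr_ge0.
    by rewrite -natrX ltr_nat ltn_expl.
  rewrite ler_wpM2l ?exprn_ge0 // lerXn2r ?nnegrE ?exprn_ge0 //.
  by rewrite -natrX ler_nat up_logP.
rewrite natrD natrM mulrDl; apply: lerD.
  by rewrite ler_peMr // lerDl ln_nat_ge0.
by rewrite -mulrA ler_wpM2l // up_log2_ln.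
Qed.

(** The integer just above the real [k]-th root of [n] is at most twice that root once [n >= 1]. *)
Lemma root_bound (n k : nat) : (1 < k)%N -> exists D : nat,
  (n < D ^ k)%N /\ (n * D)%:R <= 2 * n%:R `^ (1 + k%:R^-1) :> R.
Proof.
move=> k1; pose t : R := n%:R `^ k%:R^-1; exists (Num.truncn t).+1.
have t0 : 0 <= t by apply: powR_ge0.
have /andP [tt tt1] := truncn_itv t0.
have k0 : (k%:R : R) != 0 by rewrite pnatr_eq0; lia.
split.
  rewrite -(ltr_nat R) natrX.
  have -> : n%:R = t ^+ k by rewrite -powR_mulrn // -powRrM mulVf // powRr1.
  by rewrite ltrXn2r // ?nnegrE //; lia.
case: n @t t0 tt tt1 => [|n] t t0 tt tt1; first by rewrite mul0n mulr_ge0 // powR_ge0.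
rewrite powRD; last by rewrite pnatr_eq0 implybT.
rewrite powRr1 // -/t natrM mulrCA ler_wpM2l // -natr1.
suff : 1 <= t by lra.
have <- : 1 `^ k%:R^-1 = 1 :> R by rewrite powR1.
by rewrite ge0_ler_powR ?nnegrE ?invr_ge0 // ler1n.
Qed.

Lemma spanner_cost : exists C : R, 0 <= C /\
  forall n k s, (1 < k)%N -> exists c D : nat,
  [/\ ((n ^ 2).+1 <= 2 ^ c)%N, (n < D ^ k)%N &
    (c * (s + n * D))%:R <=
      C * (1 + ln n%:R) * (s%:R + n%:R `^ (1 + k%:R^-1)) :> R].
Proof.
pose K : R := 1 + (ln 2)^-1.
have K0 : 0 <= K by rewrite addr_ge0 // invr_ge0 ln_nat_ge0.
exists ((2 * K + 1) * 2); split; first by rewrite mulr_ge0 // addr_ge0 // mulr_ge0.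
move=> n k s k1; have [D [nD Db]] := root_bound n k1.
(* The extra bit absorbs the [+ 1] in [n ^ 2 + 1]. *)
exists (2 * up_log 2 n).+1, D; split=> //.
  rewrite [leqRHS]expnS [(2 * up_log _ _)%N]mulnC expnM.
  have : (n ^ 2 <= (2 ^ up_log 2 n) ^ 2)%N by rewrite leq_exp2r // up_logP.
  have : (0 < (2 ^ up_log 2 n) ^ 2)%N by rewrite !expn_gt0.
  lia.
have l0 := ln_nat_ge0 n.
have -> : (2 * K + 1) * 2 * (1 + ln n%:R) * (s%:R + n%:R `^ (1 + k%:R^-1)) =
  ((2 * K + 1) * (1 + ln n%:R)) * (2 * (s%:R + n%:R `^ (1 + k%:R^-1))) by ring.
rewrite natrM; apply: ler_pM => //.
  have -> : (2 * up_log 2 n).+1%:R = 2 * (up_log 2 n)%:R + 1 :> R.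
    by rewrite -natr1 natrM.
  rewrite [leRHS]mulrDl mul1r; apply: lerD; last by rewrite lerDl.
  by rewrite -mulrA ler_wpM2l // up_log2_ln.
rewrite natrD mulrDr; apply: lerD => //.
by rewrite ler_peMl // ler1n.
Qed.

Lemma dyadic_level L (r : R) : 1 <= r -> r < 2 ^+ L ->
  exists2 j, (j < L)%N & 2 ^+ j <= r < 2 ^+ j.+1.
Proof.
move=> r1; elim: L => [|L IH] rL; first by move: rL; rewrite expr0; lra.
have [/IH [j jL jr]|Lr] := ltP r (2 ^+ L); first by exists j => //; apply: ltnW.
by exists L => //; rewrite Lr.
Qed.

End Asymptotics.

(** * From protocols to communication complexity *)

Lemma comm_complexity_le (R : realType) s X Y I (legal : set I)
    (view : I -> 'I_s -> X) (sol : I -> set Y) p c (b : R) :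
  solves_with legal view sol p c -> c%:R <= b ->
  (comm_complexity R legal view sol <= b%:E)%E.
Proof.
move=> pc cb; apply: ge_ereal_inf; exists (c%:R)%:E; last by rewrite lee_fin.
by exists c => //; exists p.
Qed.

Theorem theorem2 (R : realType) :
  (forall w : nat -> R, poly_bounded w ->
    exists (C : R) (d : nat), forall (V : finType) (s k : nat) (dup : bool),
      (1 < k)%N ->
      (comm_complexity R (@weighted_graph R V s dup (w #|V|))
         (@site_view R V s) (@spanner R V s (4 * k%:R - 2))
       <= (soft_bound C d #|V| (s%:R + #|V|%:R `^ (1 + k%:R^-1)))%:E)%E)
  /\
  (exists (C : R) (d : nat), forall (V : finType) (s k : nat) (dup : bool),
      (1 < k)%N ->
      (comm_complexity R (@unweighted_graph R V s dup)
         (@site_view R V s) (@spanner R V s (2 * k%:R - 1))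
       <= (soft_bound C d #|V| (s%:R + #|V|%:R `^ (1 + k%:R^-1)))%:E)%E).
Proof.
have [C0 [C00 cost]] := spanner_cost R.
split=> [w /poly_levels [C1 [C10 levels]]|].
  (* One logarithmic factor comes from the number of levels, the other from the length of an
     announcement. *)
  exists (C1 * C0), 2%N => V s k dup k1.
  have [c [D [Vc VD cD]]] := cost #|V| k s k1; have [L [wL LC]] := levels #|V|.
  have := @level_protocol R V s k c D L (weighted_graph dup (w #|V|))
    (fun j r => 2 ^+ j <= r < 2 ^+ j.+1) 2 (ltnW k1) VD Vc (ltr0n _ _).
  case=> [g [[]] //|g e [[g2 _] gw] eg|j r t|p pP].
  - have /andP [W1 Ww] := gw e eg; split; first exact: le_trans W1.
    (* The level bound is only available for a nonempty vertex set, which the edge [e] provides. *)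
    have n0 : (0 < #|V|)%N.
      have /card_gt0P [x _] : (0 < #|e|)%N by rewrite g2.
      by apply/card_gt0P; exists x.
    apply: dyadic_level W1 (le_lt_trans Ww (wL n0)).
  - move=> /andP [_ r2] /andP [t2 _]; apply/ltW/(lt_le_trans r2).
    by rewrite exprS ler_pM2l.
  have -> : 4 * k%:R - 2 = 2 * (2 * k%:R - 1) :> R by ring.
  apply: comm_complexity_le pP _; rewrite natrM /soft_bound.
  apply: le_trans (ler_pM _ _ LC cD) _ => //.
  by rewrite expr2 le_eqVlt; apply/orP; left; apply/eqP; ring.
(* With a single level, only the length of an announcement contributes a logarithm. *)
exists C0, 1%N => V s k dup k1.
have [c [D [Vc VD cD]]] := cost #|V| k s k1.
have := @level_protocol R V s k c D 1 (unweighted_graph dup)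
    (fun _ r => r == 1) 1 (ltnW k1) VD Vc ltr01.
case=> [g [[]] //|g e [_ g1] eg|j r t|p pP].
- by rewrite g1 //; split=> //; exists 0%N.
- by move=> /eqP -> /eqP ->; rewrite mul1r.
rewrite mul1r mul1n in pP; apply: comm_complexity_le pP _.
by rewrite /soft_bound expr1.
Qed.
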